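(* Let $X,Y,Z,W$ be locally convex topological vector spaces, with $Y$ and $Z$ ordered by convex cones $Y_+$ and $Z_+$, $\operatorname{int}Y_+\neq\emptyset$, and let $f:X\to 2^Y$, $g:X\to 2^Z$, $h:X\to 2^W$ be set-valued maps. Consider the problem (VP): $Y_+$-minimize $f(x)$ subject to $g(x)\cap(-Z_+)\neq\emptyset$, $0_W\in h(x)$, $x\in X$, with feasible set $D=\{x\in X: g(x)\cap(-Z_+)\neq\emptyset,\ 0_W\in h(x)\}$. Let $E$ be a linear subspace of $W$ and let $\bar x\in D$. If there exist $\bar\xi\in Y_+^*\setminus\{0_{Y^*}\}$ and $(\bar\eta,\bar\varsigma)\in Z_+^*\times W^*$ such that $(\bar x,\bar\eta,\bar\varsigma)$ is a saddle point of the Lagrangian mapping $l_{\bar\xi}$, then $\bar x$ is a properly efficient solution of (VP), and $\bar\eta(g(\bar x))=\{0\}$, $\bar\varsigma(h(\bar x))=\{0\}$.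
   Context: All vector spaces are real. For a topological vector space $V$, $V^*$ is its topological dual; for a convex cone $V_+\subseteq V$, $V_+^*=\{\xi\in V^*:\xi(v)\ge 0\ \forall v\in V_+\}$. For $\xi \in V^*$ and $A\subseteq V$, $\xi(A)=\{\xi(a):a\in A\}$; sums of sets are elementwise. For $A,B\subseteq\mathbb R$, $A\ge B$ (equivalently $B\le A$) means $a\ge b$ for all $a\in A$, $b\in B$. For $\bar\xi\in Y_+^*\setminus\{0_{Y^*}\}$, the (set-valued, real) Lagrangian mapping of (VP) is $l_{\bar\xi}(x,\eta,\varsigma)=\bar\xi(f(x))+\eta(g(x))+\varsigma(h(x))\subseteq\mathbb R$ for $(x,\eta,\varsigma)\in X\times Z_+^*\times W^*$. A triple $(\bar x,\bar\eta,\bar\varsigma)$ is a saddle point of $l_{\bar\xi}$ if $l_{\bar\xi}(\bar x,\eta,\varsigma)\le l_{\bar\xi}(\bar x,\bar\eta,\bar\varsigma)\le l_{\bar\xi}(x,\bar\eta,\bar\varsigma)$ for all $x\in D$ and all $(\eta,\varsigma)\in Z_+^*\times W^*$. $\bar x\in D$ is a properly efficient solution of (VP) if there is $\xi\in Y_+^*\setminus\{0_{Y^*}\}$ such that $\xi(f(x))\ge\xi(f(\bar x))$ for all $x\in D$.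
   Formalization: The formal theorem additionally assumes that f(x̄) is nonempty; if f(x̄) is empty, the saddle-point condition is vacuous and η̄(g(x̄)) = {0} can fail. *)

(* Defs.v *)
From HB Require Import structures.
From mathcomp Require Import all_boot all_order all_algebra.
From mathcomp Require Import all_classical all_reals all_analysis.

Set Implicit Arguments.
Unset Strict Implicit.
Unset Printing Implicit Defensive.

Import Order.TTheory GRing.Theory Num.Theory.
Import numFieldNormedType.Exports.

Local Open Scope classical_set_scope.
Local Open Scope ring_scope.

(* Scaling by 0 is allowed, so a convex cone contains the origin and the
   relation it induces is reflexive. Pointedness and closedness are not
   required. *)
Definition convex_cone (R : realType) (V : tvsType R) (C : set V) : Prop :=
  [/\ C !=set0,
      forall (a : R) (v : V), 0 <= a -> C v -> C (a *: v)
    & convex_set C].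

Definition topological_dual (R : realType) (V : tvsType R) : set {linear V -> R^o} :=
  [set xi | continuous xi].

Definition dual_cone (R : realType) (V : tvsType R) (C : set V) :
    set {linear V -> R^o} :=
  [set xi | topological_dual xi /\ forall v, C v -> 0 <= xi v].

Definition set_le (R : realType) (A B : set R) : Prop :=
  forall a b, A a -> B b -> a <= b.

Definition set_add (R : realType) (A B : set R) : set R :=
  [set a + b | a in A & b in B].

Definition feasible (R : realType) (X Z W : tvsType R) (Zp : set Z)
    (g : X -> set Z) (h : X -> set W) : set X :=
  [set x | (g x `&` (-%R @` Zp)) !=set0 /\ h x 0].

Definition lagrangian (R : realType) (X Y Z W : tvsType R)
    (f : X -> set Y) (g : X -> set Z) (h : X -> set W)
    (xi : {linear Y -> R^o}) (x : X)
    (eta : {linear Z -> R^o}) (sigma : {linear W -> R^o}) : set R :=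
  set_add (set_add (xi @` f x) (eta @` g x)) (sigma @` h x).

Definition saddle_point (R : realType) (X Z W : tvsType R)
    (D : set X) (Zp : set Z)
    (l : X -> {linear Z -> R^o} -> {linear W -> R^o} -> set R)
    (xbar : X) (etabar : {linear Z -> R^o}) (sigmabar : {linear W -> R^o}) :
    Prop :=
  forall (x : X) (eta : {linear Z -> R^o}) (sigma : {linear W -> R^o}),
    D x -> dual_cone Zp eta -> topological_dual sigma ->
    set_le (l xbar eta sigma) (l xbar etabar sigmabar) /\
    set_le (l xbar etabar sigmabar) (l x etabar sigmabar).

Definition properly_efficient (R : realType) (X Y : tvsType R)
    (Yp : set Y) (f : X -> set Y) (D : set X) (xbar : X) : Prop :=
  D xbar /\
  exists xi : {linear Y -> R^o},
    [/\ dual_cone Yp xi, (xi : Y -> R) <> cst 0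
      & forall x, D x -> set_le (xi @` f xbar) (xi @` f x)].

(* Main.v *)
Require Import Defs.
From mathcomp Require Import all_boot all_order all_algebra.
From mathcomp Require Import all_classical all_reals all_analysis.
From mathcomp Require Import lra.

(** The first saddle-point inequality says that, over all admissible
    multipliers, the Lagrangian at [xbar] is maximal at the given pair
    [(etabar, sigmabar)].  Since the multipliers range over cones, a linear
    expression that is bounded above on them by its own value at one point must
    vanish there: comparing [sigmabar] with [- sigmabar] and [etabar] with [0]
    and with [2 *: etabar] forces [sigmabar] to vanish on [h xbar] and [etabar]
    to vanish on [g xbar] (complementary slackness).  The comparisons use only
    points of the form [y + z + w] with all but one summand kept fixed, which
    is possible because [f xbar], [g xbar] and [h xbar] are nonempty.

    With these two terms gone, the second inequality bounds [xibar] on [f xbar]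
    by [xibar y + etabar z + sigmabar w] for all [y], [z], [w] in the images of
    a feasible [x].  Feasibility supplies [w = 0] and some [z] in [- Zp], where
    [etabar z <= 0], so [xibar] itself certifies proper efficiency. *)

Import Order.TTheory GRing.Theory Num.Theory.
Import numFieldNormedType.Exports.

Local Open Scope classical_set_scope.
Local Open Scope ring_scope.

Lemma topological_dual_scale (R : realType) (V : tvsType R) (a : R)
    (xi : {linear V -> R^o}) :
  topological_dual xi -> topological_dual (a \*: xi).
Proof. by move=> xi_cont v; apply: cvgZl_tmp; exact: xi_cont. Qed.
Arguments topological_dual_scale {R V} a {xi}.

Lemma dual_cone_scale (R : realType) (V : tvsType R) (C : set V) (a : R)
    (xi : {linear V -> R^o}) :
  0 <= a -> dual_cone C xi -> dual_cone C (a \*: xi).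
Proof.
move=> a_ge0 [xi_cont xi_ge0]; split; first exact: topological_dual_scale.
by move=> v Cv; apply: mulr_ge0 => //; exact: xi_ge0.
Qed.
Arguments dual_cone_scale {R V C a xi}.

Lemma dual_cone_le0 (R : realType) (V : tvsType R) (C : set V)
    (xi : {linear V -> R^o}) (v : V) :
  dual_cone C xi -> (-%R @` C) v -> xi v <= 0.
Proof.
by move=> [_ xi_ge0] [c Cc <-]; rewrite linearN /= oppr_le0; exact: xi_ge0.
Qed.
Arguments dual_cone_le0 {R V C xi v}.

Lemma lagrangian_mem (R : realType) (X Y Z W : tvsType R)
    (f : X -> set Y) (g : X -> set Z) (h : X -> set W)
    (xi : {linear Y -> R^o}) (x : X)
    (eta : {linear Z -> R^o}) (sigma : {linear W -> R^o})
    (y : Y) (z : Z) (w : W) :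
  f x y -> g x z -> h x w ->
  lagrangian f g h xi x eta sigma (xi y + eta z + sigma w).
Proof.
move=> fy gz hw; exists (xi y + eta z); last by exists (sigma w) => //; exists w.
by exists (xi y); [exists y | exists (eta z) => //; exists z].
Qed.
Arguments lagrangian_mem {R X Y Z W f g h xi x eta sigma y z w}.

Lemma image_eq_set1 (T U : Type) (A : set T) (k : T -> U) (u : U) :
  A !=set0 -> (forall a, A a -> k a = u) -> k @` A = [set u].
Proof.
move=> [a Aa] kA; apply/seteqP; split=> [_ [b Ab <-]|_ ->]; first exact: kA.
by exists a => //; exact: kA.
Qed.

Section ComplementarySlackness.
Context {R : realType} {X Y Z W : tvsType R} (Zp : set Z).
Context (f : X -> set Y) (g : X -> set Z) (h : X -> set W).
Context (xi : {linear Y -> R^o}) (x : X).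
Context (etabar : {linear Z -> R^o}) (sigmabar : {linear W -> R^o}).
Hypothesis etabar_dual : dual_cone Zp etabar.
Hypothesis sigmabar_dual : topological_dual sigmabar.
Hypothesis multipliers_max : forall eta sigma,
  dual_cone Zp eta -> topological_dual sigma ->
  set_le (lagrangian f g h xi x eta sigma)
         (lagrangian f g h xi x etabar sigmabar).
Hypothesis fx_neq0 : f x !=set0.
Hypothesis hx0 : h x 0.

(** With [y], [z] and [etabar] held fixed, maximality against the point [0] of
    [h x] reads [sigma w <= 0] for every [sigma]; the dual space is symmetric. *)
Lemma equality_slackness (w : W) : g x !=set0 -> h x w -> sigmabar w = 0.
Proof.
move=> [z gz] hw; have [y fy] := fx_neq0.
have le0 a : a * sigmabar w <= 0.
  have := multipliers_max _ _ etabar_dual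
    (topological_dual_scale a sigmabar_dual)
    _ _ (lagrangian_mem fy gz hw)
    (lagrangian_mem fy gz hx0).
  by rewrite linear0 addr0 gerDl.
by have := le0 1; have := le0 (-1); lra.
Qed.

(** Along the ray of multipliers [a *: etabar], [a >= 0], maximality at [a = 1]
    is an inequality in both directions, as [1] is interior to the ray. *)
Lemma inequality_slackness (z : Z) : g x z -> etabar z = 0.
Proof.
move=> gz; have [y fy] := fx_neq0.
have ray_le a : 0 <= a -> a * etabar z <= etabar z.
  move=> a_ge0.
  have := multipliers_max _ _ (dual_cone_scale a_ge0 etabar_dual)
    sigmabar_dual
    _ _ (lagrangian_mem fy gz hx0)
    (lagrangian_mem fy gz hx0).
  by rewrite lerD2r lerD2l.
by have := ray_le 0 (lexx 0); have := ray_le 2 (ler0n _ 2); lra.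
Qed.

End ComplementarySlackness.
Arguments equality_slackness {R X Y Z W Zp f g h xi x etabar sigmabar} _ _ _ _ _ {w}.
Arguments inequality_slackness {R X Y Z W Zp f g h xi x etabar sigmabar} _ _ _ _ _ {z}.

Theorem theorem5 (R : realType) (X Y Z W : tvsType R)
    (Yp : set Y) (Zp : set Z)
    (hYp : convex_cone Yp) (hZp : convex_cone Zp) (hint : interior Yp !=set0)
    (f : X -> set Y) (g : X -> set Z) (h : X -> set W)
    (E : {pred W}) (hE : GRing.submod_closed E)
    (xbar : X) (hxbar : feasible Zp g h xbar) (hf : f xbar !=set0)
    (xibar : {linear Y -> R^o})
    (hxi : dual_cone Yp xibar) (hxi0 : (xibar : Y -> R) <> cst 0)
    (etabar : {linear Z -> R^o}) (sigmabar : {linear W -> R^o})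
    (heta : dual_cone Zp etabar) (hsigma : topological_dual sigmabar)
    (hsaddle : saddle_point (feasible Zp g h) Zp
                 (lagrangian f g h xibar) xbar etabar sigmabar) :
  [/\ properly_efficient Yp f (feasible Zp g h) xbar,
      etabar @` g xbar = [set 0]
    & sigmabar @` h xbar = [set 0]].
Proof.
have [[zbar [gzbar _]] hbar0] := hxbar.
have multipliers_max eta sigma : dual_cone Zp eta -> topological_dual sigma ->
    set_le (lagrangian f g h xibar xbar eta sigma)
           (lagrangian f g h xibar xbar etabar sigmabar).
  by move=> eta_dual sigma_dual; have [] := hsaddle _ _ _ hxbar eta_dual sigma_dual.
have etabar0 z : g xbar z -> etabar z = 0.
  by exact: (inequality_slackness heta hsigma multipliers_max hf hbar0).
have sigmabar0 w : h xbar w -> sigmabar w = 0.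
  by apply: (equality_slackness heta hsigma multipliers_max hf hbar0); exists zbar.
split; last 2 first.
- by apply: image_eq_set1 => //; exists zbar.
- by apply: image_eq_set1 => //; exists 0.
split=> //; exists xibar; split=> // x Dx _ _ [ybar fybar <-] [y fy <-].
have [[z [gz Nz]] h0] := Dx.
have [_ xbar_min] := hsaddle _ _ _ Dx heta hsigma.
have := xbar_min _ _ (lagrangian_mem fybar gzbar hbar0)
  (lagrangian_mem fy gz h0).
rewrite etabar0 // linear0 !addr0 => /le_trans; apply.
by rewrite gerDl; exact: dual_cone_le0 heta Nz.
Qed.
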